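(* For every positive integer $n$, the number $S_n(1324)$ of permutations of length $n$ that avoid the pattern $1324$ satisfies \[ S_n(1324) < (7+4\sqrt{3})^n. \]
   Context: A permutation of length $n$ is written in one-line notation $p=p_1p_2\cdots p_n$. A permutation $p=p_1\cdots p_n$ avoids a pattern $q=q_1q_2\cdots q_k$ (a permutation of length $k$) if there are no $k$ indices $i_1<i_2<\cdots<i_k$ such that for all $a$ and $b$, $p_{i_a}<p_{i_b}$ holds if and only if $q_a<q_b$ holds. In particular $p$ avoids $1324$ if there are no indices $i_1<i_2<i_3<i_4$ with $p_{i_1}<p_{i_3}<p_{i_2}<p_{i_4}$. $S_n(1324)$ denotes the number of permutations of length $n$ avoiding $1324$. *)

(* Defs.v *)
From mathcomp Require Import all_boot all_fingroup.

Set Implicit Arguments.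
Unset Strict Implicit.
Unset Printing Implicit Defensive.

(* Permutations of length n are elements of 'S_n; positions and values are both
   shifted to {0, ..., n-1}, and p_j is [p j]. *)

(* The increasing choice of k positions i_1 < ... < i_k is the finite function i. *)
Definition avoids (n k : nat) (p : 'S_n) (q : 'S_k) : bool :=
  ~~ [exists i : {ffun 'I_k -> 'I_n},
        [forall a : 'I_k, forall b : 'I_k, (a < b)%N ==> (i a < i b)%N] &&
        [forall a : 'I_k, forall b : 'I_k, (p (i a) < p (i b))%N == (q a < q b)%N]].

Definition num_avoiding (n k : nat) (q : 'S_k) : nat :=
  #|[set p : 'S_n | avoids p q]|.

(* 1324 exchanges the two middle positions; see pattern1324_oneline. *)
Definition pattern1324 : 'S_4 := tperm (inord 1) (inord 2).

Lemma pattern1324_oneline :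
  [seq (val (pattern1324 a)).+1 | a <- enum 'I_4] = [:: 1; 3; 2; 4]%N.
Proof.
rewrite !enum_ordSl /= (size0nil (size_enum_ord 0)) /=.
by rewrite !permE /= -!val_eqE /= !inordK.
Qed.

Lemma avoids1324P (n : nat) (p : 'S_n) :
  avoids p pattern1324 <->
  ~ exists i1 i2 i3 i4 : 'I_n,
      [/\ (i1 < i2)%N, (i2 < i3)%N & (i3 < i4)%N] /\
      [/\ (p i1 < p i3)%N, (p i3 < p i2)%N & (p i2 < p i4)%N].
Proof.
have q1 (a : 'I_4) : pattern1324 a = nth 0%N [:: 0; 2; 1; 3]%N a :> nat.
  rewrite /pattern1324 permE /= -!val_eqE /= !inordK //.
  by case: a => [[|[|[|[|m]]]] Ha] //=; rewrite inordK.
split.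
- move=> /negP av [i1 [i2 [i3 [i4 [[l12 l23 l34] [m13 m32 m24]]]]]]; apply: av.
  apply/existsP; exists [ffun a : 'I_4 => nth i1 [:: i1; i2; i3; i4] a].
  have l13 := ltn_trans l12 l23; have l24 := ltn_trans l23 l34.
  have l14 := ltn_trans l13 l34; have m12 := ltn_trans m13 m32.
  have m34 := ltn_trans m32 m24; have m14 := ltn_trans m12 m24.
  apply/andP; split; apply/forallP => a; apply/forallP => b; rewrite !ffunE ?q1.
    by case: a b => [[|[|[|[|a]]]] Ha] [[|[|[|[|b]]]] Hb].
  case: a b => [[|[|[|[|a]]]] Ha] [[|[|[|[|b]]]] Hb] //=; rewrite ?ltnn //;
  by rewrite ?m13 ?m32 ?m24 ?m12 ?m34 ?m14 // ltnNge ltnW.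
- move=> nex; apply/negP => /existsP[i /andP[/forallP up /forallP same]].
  have L (a b : 'I_4) : (a < b)%N -> (i a < i b)%N.
    by move/forallP: (up a) => /(_ b)/implyP.
  have M (a b : 'I_4) :
      (nth 0%N [:: 0; 2; 1; 3]%N a < nth 0%N [:: 0; 2; 1; 3]%N b)%N ->
      (p (i a) < p (i b))%N.
    by move/forallP: (same a) => /(_ b)/eqP ->; rewrite !q1.
  apply: nex; exists (i (inord 0)), (i (inord 1)), (i (inord 2)), (i (inord 3)).
  by split; split; do 1?[apply: L; rewrite !inordK] => //;
     apply: M; rewrite !inordK.
Qed.

(* Main.v *)
Require Import Defs.
From mathcomp Require Import all_boot all_order all_fingroup all_algebra.
From mathcomp Require Import zify ring lra.
Import Order.TTheory GRing.Theory Num.Theory.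
Local Open Scope ring_scope.

(** Read [p] from left to right, colouring an entry blue when it would complete
    a red 132 pattern or when it exceeds an earlier blue entry, and red
    otherwise. If [p] avoids 1324, the red entries avoid 132 and the blue ones
    avoid 213. Record for every entry its colour and whether it is a red
    left-to-right minimum (A), another red entry (B), a blue right-to-left
    maximum (D) or another blue entry (C). The word of labels by position and
    the word of labels by value together determine [p], neither contains the
    factor CB, and neither starts with B. Words of length [n] with the last two
    properties number fewer than [(2 + sqrt 3) ^ n], and
    [(2 + sqrt 3) ^ 2 = 7 + 4 sqrt 3]. *)

(** * The colouring and the patterns its classes avoid *)

(* [k] is fuel: the colour of position [i] is settled as soon as [i < k]. *)
Fixpoint blue_upto {n : nat} (p : 'S_n) (k : nat) (i : 'I_n) : bool :=
  if k is k'.+1 then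
    [exists x : 'I_n, exists y : 'I_n,
       [&& (x < y)%N, (y < i)%N, ~~ blue_upto p k' x, ~~ blue_upto p k' y,
           (p x < p i)%N & (p i < p y)%N]]
    || [exists b : 'I_n, [&& blue_upto p k' b, (b < i)%N & (p b < p i)%N]]
  else false.

Definition blue {n : nat} (p : 'S_n) (i : 'I_n) : bool := blue_upto p n i.

Lemma blue_upto_stable (n : nat) (p : 'S_n) (k l : nat) (i : 'I_n) :
  (i < k)%N -> (i < l)%N -> blue_upto p k i = blue_upto p l i.
Proof.
elim: k l i => [|k IH] [|l] i //= ik il.
congr orb.
  apply: eq_existsb => x; apply: eq_existsb => y.
  case xy: (x < y)%N => //=; case yi: (y < i)%N => //=.
  by rewrite (IH l x) ?(IH l y) //; lia.
apply: eq_existsb => b.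
case bi: (b < i)%N; rewrite ?andbF //=.
by rewrite (IH l b) //; lia.
Qed.

Lemma blueP (n : nat) (p : 'S_n) (i : 'I_n) :
  blue p i <->
  (exists x y : 'I_n, [/\ (x < y)%N, (y < i)%N, ~~ blue p x & ~~ blue p y] /\
                      ((p x < p i)%N /\ (p i < p y)%N)) \/
  (exists b : 'I_n, [/\ blue p b, (b < i)%N & (p b < p i)%N]).
Proof.
(* One extra unit of fuel, so that a single unfolding leaves [blue] itself in the recursive
   calls. *)
rewrite /blue (@blue_upto_stable n p n n.+1 i) //=; last by rewrite ltnS ltnW.
split.
  case/orP => [/existsP[x /existsP[y /and5P[? ? ? ? /andP[? ?]]]]|].
    by left; exists x, y.
  case/existsP=> b /and3P[? ? ?].
  by right; exists b.
case=> [[x [y [[h1 h2 h3 h4] [h5 h6]]]]|[b [h1 h2 h3]]]; apply/orP.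
  left; apply/existsP; exists x; apply/existsP; exists y.
  by rewrite h1 h2 h3 h4 h5.
by right; apply/existsP; exists b; rewrite h1 h2.
Qed.

Lemma red_avoids_132 (n : nat) (p : 'S_n) (x y z : 'I_n) :
  ~~ blue p x -> ~~ blue p y -> ~~ blue p z -> (x < y)%N -> (y < z)%N ->
  (p x < p z)%N -> (p z < p y)%N -> False.
Proof.
move=> rx ry /negP rz xy yz xz zy; apply: rz; apply/blueP.
by left; exists x, y.
Qed.

Lemma blue_up (n : nat) (p : 'S_n) (b i : 'I_n) :
  blue p b -> (b < i)%N -> (p b < p i)%N -> blue p i.
Proof. by move=> bb bi pbi; apply/blueP; right; exists b. Qed.

(** Passing repeatedly to an earlier, smaller blue entry must stop at some [d] coloured by the first
    rule, where the 3 of its 132 is red. *)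
Lemma blue_ends_132 (n : nat) (p : 'S_n) (i : 'I_n) :
  blue p i -> exists x y d : 'I_n,
    [/\ (x < y)%N, (y < d)%N, (d <= i)%N & ~~ blue p y] /\
    [/\ (p x < p d)%N, (p d < p y)%N & (p d <= p i)%N].
Proof.
have [m] := ubnP (i : nat).
elim: m i => // m IH i im /blueP[[x [y [[xy yi rx ry] [h1 h2]]]]|[b [bb bi pbi]]].
  by exists x, y, i.
have [x [y [d [[h1 h2 h3 h4] [h5 h6 h7]]]]] := IH b ltac:(lia) bb.
by exists x, y, d; do 2!split => //; lia.
Qed.

Lemma avoids1324_false (n : nat) (p : 'S_n) (i1 i2 i3 i4 : 'I_n) :
  avoids p pattern1324 -> (i1 < i2)%N -> (i2 < i3)%N -> (i3 < i4)%N ->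
  (p i1 < p i3)%N -> (p i3 < p i2)%N -> (p i2 < p i4)%N -> False.
Proof. by move=> /avoids1324P av *; apply: av; exists i1, i2, i3, i4. Qed.

Lemma val_perm_inj (n : nat) (p : 'S_n) (i j : 'I_n) :
  p i = p j :> nat -> i = j :> nat.
Proof. by move/val_inj/perm_inj ->. Qed.

(** Take a 132 [x], [y], [d] with [d] weakly left of and below [a]. If [y] is below [c], then
    [x y d c] is a 1324; otherwise, if [y] precedes [b], then [x b a c] is one; otherwise [y] lies
    to the right of and above [b], so it would be blue. *)
Lemma blue_avoids_213 (n : nat) (p : 'S_n) (b a c : 'I_n) :
  avoids p pattern1324 -> blue p b -> blue p a ->
  (b < a)%N -> (a < c)%N -> (p a < p b)%N -> (p b < p c)%N -> False.
Proof.
move=> av bb ba ltba ltac pab pbc.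
have [x [y [d [[xy yd da ry] [pxd pdy pda]]]]] := blue_ends_132 _ _ _ ba.
have [pyc|pcy] := ltnP (p y) (p c).
  by apply: (@avoids1324_false n p x y d c) => //; lia.
have [yb|by_] := ltnP y b.
  by apply: (@avoids1324_false n p x b a c) => //; lia.
have neq : y <> b :> nat by move=> /val_inj E; move: ry; rewrite E bb.
by move/negP: ry; apply; apply: (blue_up n p b) => //; lia.
Qed.

(** * Labels and the two label words *)

(** Comparing only entries of one colour changes nothing, by [blue_up], and yields a witness of the
    same colour as [i]. *)
Definition nonextremal {n : nat} (p : 'S_n) (i : 'I_n) : bool :=
  if blue p i then [exists y : 'I_n, [&& blue p y, (i < y)%N & (p i < p y)%N]]
  else [exists x : 'I_n, [&& ~~ blue p x, (x < i)%N & (p x < p i)%N]].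

(* The letters A, B, C, D are (false, false), (false, true), (true, true) and
   (true, false). *)
Definition label {n : nat} (p : 'S_n) (i : 'I_n) : bool * bool :=
  (blue p i, nonextremal p i).

Definition not_CB : rel (bool * bool) :=
  fun u v => ~~ ((u == (true, true)) && (v == (false, true))).

Definition position_word {n : nat} (p : 'S_n) : seq (bool * bool) :=
  [seq label p i | i <- enum 'I_n].

Definition value_word {n : nat} (p : 'S_n) : seq (bool * bool) :=
  [seq label p ((p^-1)%g v) | v <- enum 'I_n].

Lemma label_B (n : nat) (p : 'S_n) (i : 'I_n) :
  label p i = (false, true) ->
  ~~ blue p i /\ exists x : 'I_n, (x < i)%N /\ (p x < p i)%N.
Proof.
rewrite /label /nonextremal; case: (blue p i) => // -[] /existsP[x /and3P[_ ? ?]].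
by split => //; exists x.
Qed.

Lemma label_C (n : nat) (p : 'S_n) (i : 'I_n) :
  label p i = (true, true) ->
  blue p i /\ exists y : 'I_n, (i < y)%N /\ (p i < p y)%N.
Proof.
rewrite /label /nonextremal; case: (blue p i) => // -[] /existsP[x /and3P[_ ? ?]].
by split => //; exists x.
Qed.

(** The red [j] must lie below the blue [i]. Since the positions are adjacent, the witness [x] for B
    precedes both and the witness [y] for C follows both, so [x i j y] is a 1324. *)
Lemma position_no_CB (n : nat) (p : 'S_n) (i j : 'I_n) :
  avoids p pattern1324 -> j = i.+1 :> nat -> not_CB (label p i) (label p j).
Proof.
move=> av ij; apply/negP => /andP[/eqP/label_C[bi [y [iy piy]]]].
move=> /eqP/label_B[rj [x [xj pxj]]].
have lt : (p j < p i)%N.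
  rewrite ltnNge; apply/negP => le; move/negP: rj; apply.
  have ne : p i <> p j :> nat by move/val_perm_inj; lia.
  by apply: (blue_up n p i) => //; lia.
have yj : y <> j :> nat by move=> /val_inj E; move: piy; rewrite E; lia.
have xi : x <> i :> nat by move=> /val_inj E; move: pxj; rewrite E; lia.
by apply: (@avoids1324_false n p x i j y) => //; lia.
Qed.

(** The same argument with positions and values exchanged; the 1324 is now [x j i y]. *)
Lemma value_no_CB (n : nat) (p : 'S_n) (i j : 'I_n) :
  avoids p pattern1324 -> p j = (p i).+1 :> nat -> not_CB (label p i) (label p j).
Proof.
move=> av ij; apply/negP => /andP[/eqP/label_C[bi [y [iy piy]]]].
move=> /eqP/label_B[rj [x [xj pxj]]].
have lt : (j < i)%N.
  rewrite ltnNge; apply/negP => le; move/negP: rj; apply.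
  have ne : i <> j :> nat by move/val_inj => E; move: ij; rewrite E; lia.
  by apply: (blue_up n p i) => //; lia.
have yj : p y <> p j :> nat by move/val_perm_inj; lia.
have xi : p x <> p i :> nat by move/val_perm_inj; lia.
by apply: (@avoids1324_false n p x j i y) => //; lia.
Qed.

(* The sentinel C in front forbids an initial B. *)
Lemma path_not_CB (n : nat) (f : 'I_n -> bool * bool) :
  (forall i : 'I_n, i = 0%N :> nat -> f i <> (false, true)) ->
  (forall i j : 'I_n, j = i.+1 :> nat -> not_CB (f i) (f j)) ->
  path not_CB (true, true) [seq f i | i <- enum 'I_n].
Proof.
move=> f0 fS; apply/(pathP (true, true)) => k.
rewrite size_map size_enum_ord => kn.
pose i := Ordinal kn.
have nthE (j : 'I_n) : nth (true, true) [seq f i | i <- enum 'I_n] j = f j.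
  by rewrite (nth_map i) ?size_enum_ord // nth_ord_enum.
rewrite (nthE i); case: k kn @i nthE => [|k] kn i nthE /=.
  by rewrite /not_CB eqxx; apply/eqP/f0.
have kn' : (k < n)%N by lia.
by rewrite (nthE (Ordinal kn')); apply: fS.
Qed.

Lemma position_word_path (n : nat) (p : 'S_n) :
  avoids p pattern1324 -> path not_CB (true, true) (position_word p).
Proof.
move=> av; apply: path_not_CB => [i i0 /label_B[_ [x [xi _]]]|i j].
  by move: xi; rewrite i0.
exact: position_no_CB.
Qed.

Lemma value_word_path (n : nat) (p : 'S_n) :
  avoids p pattern1324 -> path not_CB (true, true) (value_word p).
Proof.
move=> av; apply: path_not_CB => [i i0 /label_B[_ [x [_]]]|i j ij].
  by rewrite permKV i0.
by apply: value_no_CB => //; rewrite !permKV.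
Qed.

(** * Recovering the permutation from its two words *)

Lemma position_word_label (n : nat) (p q : 'S_n) :
  position_word p = position_word q -> label p =1 label q.
Proof. by move/eq_in_map => E i; apply: E; rewrite mem_enum. Qed.

Lemma value_word_label (n : nat) (p q : 'S_n) (i j : 'I_n) :
  value_word p = value_word q -> p i = q j -> label p i = label q j.
Proof.
move/eq_in_map => E pq; have := E (p i); rewrite mem_enum permK pq permK.
exact.
Qed.

(* The leftmost red disagreement [p i < q i] is impossible: the value [p i] is
   taken by [q] further right, which gives a red 132 in [q], or an ascent among
   left-to-right minima in [p]. *)
Lemma red_leftmost_disagreement (n : nat) (p q : 'S_n) (i : 'I_n) :
  position_word p = position_word q -> value_word p = value_word q ->
  (forall j : 'I_n, ~~ blue p j -> (j < i)%N -> p j = q j) ->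
  ~~ blue p i -> (p i < q i)%N -> False.
Proof.
move=> /position_word_label lp lv agree ri lt.
have bE j : blue q j = blue p j by have := lp j; case.
have eE j : nonextremal q j = nonextremal p j by have := lp j; case.
(* The two displaced values: equal value words make [j] and [k] red, and agreement before [i] puts
   both to its right. *)
pose j := (q^-1)%g (p i); have qj : q j = p i by rewrite permKV.
pose k := (p^-1)%g (q i); have pk : p k = q i by rewrite permKV.
have lj := value_word_label _ _ _ i j lv (esym qj).
have lk := value_word_label _ _ _ k i lv pk.
have rj : ~~ blue p j by rewrite -bE; case: lj => <-.
have rk : ~~ blue p k by case: lk => ->; rewrite bE.
have ij : (i < j)%N.
  have ne : i <> j :> nat by move/val_inj => E; move: lt; rewrite -qj -E ltnn.
  suff : ~ (j < i)%N by lia.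
  move=> ji; have := agree _ rj ji.
  by rewrite qj => /perm_inj/(congr1 val)/=; lia.
have ik : (i < k)%N.
  have ne : i <> k :> nat by move/val_inj => E; move: lt; rewrite -pk -E ltnn.
  suff : ~ (k < i)%N by lia.
  move=> ki; have := agree _ rk ki.
  by rewrite pk => /perm_inj/(congr1 val)/=; lia.
have [ei|ei] := boolP (nonextremal p i).
  have := ei; rewrite /nonextremal (negbTE ri) => /existsP[x /and3P[rx xi pxi]].
  apply: (@red_avoids_132 n q x i j); rewrite ?bE ?qj //.
  by rewrite -agree.
have : nonextremal p k.
  rewrite /nonextremal (negbTE rk); apply/existsP; exists i.
  by rewrite ri ik pk.
by case: lk => _ ->; rewrite eE (negbTE ei).
Qed.

(** The red case under reverse-complement, which turns 132 into 213 and left-to-right minima into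
    right-to-left maxima. *)
Lemma blue_rightmost_disagreement (n : nat) (p q : 'S_n) (i : 'I_n) :
  avoids q pattern1324 ->
  position_word p = position_word q -> value_word p = value_word q ->
  (forall j : 'I_n, blue p j -> (i < j)%N -> p j = q j) ->
  blue p i -> (q i < p i)%N -> False.
Proof.
move=> av /position_word_label lp lv agree ri lt.
have bE j : blue q j = blue p j by have := lp j; case.
have eE j : nonextremal q j = nonextremal p j by have := lp j; case.
pose j := (q^-1)%g (p i); have qj : q j = p i by rewrite permKV.
pose k := (p^-1)%g (q i); have pk : p k = q i by rewrite permKV.
have lj := value_word_label _ _ _ i j lv (esym qj).
have lk := value_word_label _ _ _ k i lv pk.
have rj : blue p j by rewrite -bE; case: lj => <-.
have rk : blue p k by case: lk => ->; rewrite bE.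
have ij : (j < i)%N.
  have ne : i <> j :> nat by move/val_inj => E; move: lt; rewrite -qj -E ltnn.
  suff : ~ (i < j)%N by lia.
  move=> ji; have := agree _ rj ji.
  by rewrite qj => /perm_inj/(congr1 val)/=; lia.
have ik : (k < i)%N.
  have ne : i <> k :> nat by move/val_inj => E; move: lt; rewrite -pk -E ltnn.
  suff : ~ (i < k)%N by lia.
  move=> ki; have := agree _ rk ki.
  by rewrite pk => /perm_inj/(congr1 val)/=; lia.
have [ei|ei] := boolP (nonextremal p i).
  have := ei; rewrite /nonextremal ri => /existsP[y /and3P[ry iy piy]].
  apply: (@blue_avoids_213 n q j i y); rewrite ?bE ?qj //.
  by rewrite -agree.
have : nonextremal p k.
  rewrite /nonextremal rk; apply/existsP; exists i.
  by rewrite ri ik pk.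
by case: lk => _ ->; rewrite eE (negbTE ei).
Qed.

(** Red entries are settled by induction from the left, blue ones from the right; exchanging [p] and
    [q] covers the other sign of a disagreement. *)
Lemma words_determine (n : nat) (p q : 'S_n) :
  avoids p pattern1324 -> avoids q pattern1324 ->
  position_word p = position_word q -> value_word p = value_word q -> p = q.
Proof.
move=> avp avq pw vw.
have bE j : blue p j = blue q j by have := position_word_label _ _ _ pw j; case.
have red i : ~~ blue p i -> p i = q i.
  have [m] := ubnP (i : nat); elim: m i => // m IH i im ri.
  have agree (j : 'I_n) : ~~ blue p j -> (j < i)%N -> p j = q j.
    by move=> rj ji; apply: IH => //; lia.
  apply: val_inj; case: (ltngtP (p i) (q i)) => // lt; exfalso.
    exact: (@red_leftmost_disagreement n p q i).
  apply: (@red_leftmost_disagreement n q p i) => //; last by rewrite -bE.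
  by move=> j rj ji; rewrite agree // bE.
have blu i : blue p i -> p i = q i.
  have [m] := ubnP (n - i)%N; elim: m i => // m IH i im ri.
  have agree (j : 'I_n) : blue p j -> (i < j)%N -> p j = q j.
    by move=> rj ji; apply: IH => //; have := ltn_ord j; lia.
  apply: val_inj; case: (ltngtP (p i) (q i)) => // lt; exfalso.
    apply: (@blue_rightmost_disagreement n q p i) => //; last by rewrite -bE.
    by move=> j rj ji; rewrite agree // bE.
  exact: (@blue_rightmost_disagreement n p q i).
by apply/permP => i; case: (boolP (blue p i)); [apply: blu | apply: red].
Qed.

(** * Counting the words by a transfer matrix *)

Fixpoint path_words {T : finType} (e : rel T) (n : nat) (x : T) : seq (seq T) :=
  if n is n'.+1 then
    flatten [seq [seq y :: w | w <- path_words e n' y] | y <- enum T & e x y]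
  else [:: [::]].

Lemma mem_path_words (T : finType) (e : rel T) (n : nat) (x : T) (w : seq T) :
  size w = n -> path e x w -> w \in path_words e n x.
Proof.
elim: n x w => [|n IH] x [|y w] //= [sw] /andP[exy pw].
apply/flattenP; exists [seq y :: w' | w' <- path_words e n y].
  by apply/mapP; exists y; rewrite // mem_filter exy mem_enum.
by apply: map_f; apply: IH.
Qed.

Lemma size_path_wordsS (T : finType) (e : rel T) (n : nat) (x : T) :
  size (path_words e n.+1 x) = (\sum_(y | e x y) size (path_words e n y))%N.
Proof.
rewrite /= size_flatten /shape -map_comp sumnE big_map big_filter.
rewrite big_enum_cond /=; apply: eq_big => [y|y _]; first by rewrite ?inE ?andbT.
by rewrite /= size_map.
Qed.

(* [(1, (1 + sqrt 3) / 2)] is the eigenvector of the transfer matrix for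
   [2 + sqrt 3], with entry 1 at C. *)
Lemma size_CB_free_words (R : rcfType) (n : nat) (u : bool * bool) :
  let s : R := Num.sqrt 3 in
  if u == (true, true) then
    (size (path_words not_CB n u))%:R <= (2 + s) ^+ n
      /\ ((0 < n)%N -> (size (path_words not_CB n u))%:R < (2 + s) ^+ n)
  else (size (path_words not_CB n u))%:R < (1 + s) / 2 * (2 + s) ^+ n.
Proof.
move=> s.
have s2 : s ^+ 2 = 3 by rewrite sqr_sqrtr.
have s1 : 1 < s by rewrite -[1]sqrtr1 ltr_sqrt //; lra.
(* At [n = 0] the bound is an equality at C and strict elsewhere; the strict summands A and D make
   it strict at C from then on. *)
elim: n u => [|n IH] u.
  by rewrite !expr0 /=; case: ifP => _; [split => //; lra | lra].
have hA := IH (false, false); have hB := IH (false, true).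
have hC := IH (true, true); have hD := IH (true, false).
rewrite /= in hA hB hC hD; case: hC => hC _.
set l := (2 + s) ^+ n in hA hB hC hD.
(* This makes the step linear in [l] and [s * l]. C is followed by A, C or D, with
   [1 + 2 * ((1 + s) / 2) = 2 + s]; the other letters by all four, with [1 + 3 * ((1 + s) / 2) = (1
   + s) / 2 * (2 + s)]. *)
have sl : s * (s * l) = 3 * l by rewrite mulrA -expr2 s2.
have sumE (F : bool * bool -> nat) (P : pred (bool * bool)) :
    (\sum_(y | P y) F y =
     (if P (true, true) then F (true, true) else 0)
     + (if P (true, false) then F (true, false) else 0)
     + (if P (false, true) then F (false, true) else 0)
     + (if P (false, false) then F (false, false) else 0))%N.
  rewrite big_mkcond; pose G a b := if P (a, b) then F (a, b) else 0%N.
  rewrite (eq_bigr (fun y => G y.1 y.2)) => [|[a b] _ //].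
  rewrite -(pair_bigA _ G) /G /=.
  by rewrite !big_bool /= addnA.
rewrite size_path_wordsS sumE exprS -/l.
case: u => [] [] [] /=; rewrite ?natrD.
- by split; [lra | move=> _; lra].
- lra.
- lra.
- lra.
Qed.

Lemma num_avoiding1324_le (n : nat) :
  (num_avoiding n pattern1324
   <= size (path_words not_CB n (true, true)) ^ 2)%N.
Proof.
rewrite /num_avoiding cardE.
pose ws := path_words not_CB n (true, true).
pose f (p : 'S_n) := (position_word p, value_word p).
have -> : (size ws ^ 2 = size [seq (a, b) | a <- ws, b <- ws])%N.
  by rewrite size_allpairs mulnn.
rewrite -(size_map f); apply: uniq_leq_size.
  rewrite map_inj_in_uniq ?enum_uniq // => p q.
  by rewrite !mem_enum !inE => ap aq [pw vw]; apply: words_determine.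
move=> _ /mapP[p + ->]; rewrite mem_enum inE => av.
apply/allpairsP; exists (f p); split => //; apply: mem_path_words.
- by rewrite size_map size_enum_ord.
- exact: position_word_path.
- by rewrite size_map size_enum_ord.
- exact: value_word_path.
Qed.

Theorem mainTheorem1 (R : rcfType) (n : nat) (hn : (0 < n)%N) :
  (num_avoiding n pattern1324)%:R < (7 + 4 * Num.sqrt 3) ^+ n :> R.
Proof.
have [_ /(_ hn) lt] := @size_CB_free_words R n (true, true).
have -> : 7 + 4 * Num.sqrt 3 = (2 + Num.sqrt 3) ^+ 2 :> R.
  have s2 : Num.sqrt 3 ^+ 2 = 3 :> R by rewrite sqr_sqrtr.
  by rewrite sqrrD s2; ring.
rewrite exprAC.
have le := num_avoiding1324_le n; rewrite -(ler_nat R) in le.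
apply: le_lt_trans le _.
by rewrite natrX ltr_pXn2r // ?nnegrE // ?exprn_ge0 // addr_ge0 ?sqrtr_ge0.
Qed.
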